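(* Let $c>0$ be a constant and let $q=q(n)=\left\lfloor c\frac{n}{\ln n}\right\rfloor$. Then there are a function $\varepsilon(n)\to 0$ (as $n\to\infty$) and a constant $C>0$ depending only on $c$ such that for every $n\ge 2$ with $q(n)\ge 1$, in the Waiter-Client game on the edges of $K_n$ with bias $q=q(n)$: (i) Waiter has a strategy which forces the maximum degree of Client's graph at the end of the game to be at least $(1+\varepsilon(n))\frac{n}{q+1}$; (ii) Client has a strategy which ensures that the maximum degree of his graph at the end of the game is at most $C\frac{n}{q+1}$.
   Context: The Waiter-Client game on the edges of $K_n$ with bias $q$ (a positive integer) is a two-player perfect information game. In each round Waiter offers Client $q+1$ edges of $K_n$ that have not been previously offered; Client claims one of them and Waiter claims the remaining $q$. When fewer than $q+1$ not previously offered edges remain, Waiter claims all of them and the game ends. Client's graph is the graph on $V(K_n)$ formed by the edges claimed by Client. *)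

(* Defs.v *)
From HB Require Import structures.
From mathcomp Require Import all_boot all_order all_algebra.
From mathcomp Require Import all_classical all_reals all_analysis.

Set Implicit Arguments.
Unset Strict Implicit.
Unset Printing Implicit Defensive.

Import Order.TTheory GRing.Theory Num.Theory.
Import numFieldNormedType.Exports.

Section WaiterClient.

Variable n : nat.

Definition Kn_edges : {set {set 'I_n}} := [set e : {set 'I_n} | #|e| == 2].

Definition degree (G : {set {set 'I_n}}) (v : 'I_n) : nat :=
  #|[set e in G | v \in e]|.

Definition max_degree (G : {set {set 'I_n}}) : nat := \max_(v < n) degree G v.

(* The offered edges, and the one among them that Client claims. *)
Definition round : Type := ({set {set 'I_n}} * {set 'I_n})%type.

(* Rounds played so far, in chronological order. *)
Definition history : Type := seq round.

Definition free_edges (h : history) : {set {set 'I_n}} :=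
  Kn_edges :\: \bigcup_(r <- h) r.1.

(* Client's graph, as an edge set.  The edges left over at the end of the game
   all go to Waiter, so they do not affect it. *)
Definition client_graph (h : history) : {set {set 'I_n}} :=
  [set e in [seq r.2 | r <- h]].

Variable q : nat.

Definition legal_offer (h : history) (O : {set {set 'I_n}}) : bool :=
  (O \subset free_edges h) && (#|O| == q.+1).

Inductive play : history -> Prop :=
| play_start : play [::]
| play_round h O e :
    play h -> legal_offer h O -> e \in O -> play (rcons h (O, e)).

Definition game_over (h : history) : bool := #|free_edges h| < q.+1.

Definition waiter_strategy : Type := history -> {set {set 'I_n}}.
Definition client_strategy : Type := history -> {set {set 'I_n}} -> {set 'I_n}.

Definition legal_waiter (s : waiter_strategy) : Prop :=
  forall h, play h -> ~~ game_over h -> legal_offer h (s h).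

Definition legal_client (s : client_strategy) : Prop :=
  forall h O, play h -> legal_offer h O -> s h O \in O.

Definition follows_waiter (s : waiter_strategy) (h : history) : Prop :=
  forall h1 O e h2, h = h1 ++ (O, e) :: h2 -> O = s h1.

Definition follows_client (s : client_strategy) (h : history) : Prop :=
  forall h1 O e h2, h = h1 ++ (O, e) :: h2 -> e = s h1 O.

Definition waiter_can_force (P : {set {set 'I_n}} -> Prop) : Prop :=
  exists2 s : waiter_strategy, legal_waiter s &
    forall h, play h -> game_over h -> follows_waiter s h -> P (client_graph h).

Definition client_can_ensure (P : {set {set 'I_n}} -> Prop) : Prop :=
  exists2 s : client_strategy, legal_client s &
    forall h, play h -> game_over h -> follows_client s h -> P (client_graph h).

End WaiterClient.

Local Open Scope ring_scope.

(* Num.truncn is the floor, as a natural number, of a nonnegative real. *)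
Definition bias (R : realType) (c : R) (n : nat) : nat :=
  Num.truncn (c * (n%:R / ln n%:R)).

(* Main.v *)
(* Client claims one edge in every round, hence about C(n, 2) / (q + 1) edges in
   total, so the average degree of his graph is already (1 - O(1/n)) n / (q + 1),
   however Waiter plays.
   For the upper bound Client derandomizes the choice of a uniformly random offered
   edge: by Bernoulli's inequality, some choice does not increase
     sum_v 2 ^ deg_C(v) * (1 + 1 / (q + 1)) ^ deg_free(v).
   At the end 2 ^ Delta <= n (1 + 1 / (q + 1)) ^ n <= n exp(n / (q + 1)), where Delta
   is Client's maximum degree, and ln n <= c n / q <= 2 c n / (q + 1). *)
Require Import Defs.
From HB Require Import structures.
From mathcomp Require Import all_boot all_order all_algebra.
From mathcomp Require Import all_classical all_reals all_analysis.
From mathcomp Require Import lra zify.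

Set Implicit Arguments.
Unset Strict Implicit.
Unset Printing Implicit Defensive.

Import Order.TTheory GRing.Theory Num.Theory.
Import numFieldNormedType.Exports.
Local Open Scope ring_scope.

Section Game.

Variables n q : nat.
Implicit Types (G F O : {set {set 'I_n}}) (h : history n) (e : {set 'I_n}).

(** * Bookkeeping along a play *)

Lemma free_edges_rcons h O e : free_edges (rcons h (O, e)) = free_edges h :\: O.
Proof.
by rewrite /free_edges -cats1 big_cat big_seq1 finset.setDDl.
Qed.

Lemma client_graph_rcons h O e :
  client_graph (rcons h (O, e)) = e |: client_graph h.
Proof. by apply/setP => x; rewrite !inE map_rcons mem_rcons inE. Qed.

Lemma client_graph_offered h :
  play q h -> client_graph h \subset \bigcup_(r <- h) r.1.
Proof.
elim=> [|{}h O e _ IH _ eO]; first by apply/fintype.subsetP => x; rewrite !inE.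
rewrite client_graph_rcons -cats1 big_cat big_seq1 finset.subUset.
rewrite finset.sub1set finset.inE eO orbT /=.
exact: (fintype.subset_trans IH (finset.subsetUl _ _)).
Qed.

Lemma client_graph_Kn h : play q h -> client_graph h \subset Kn_edges n.
Proof.
elim=> [|{}h O e _ IH /andP[OF _] eO]; first by apply/fintype.subsetP => x; rewrite !inE.
rewrite client_graph_rcons finset.subUset IH andbT finset.sub1set.
exact: (fintype.subsetP (fintype.subset_trans OF (finset.subsetDl _ _))).
Qed.

(** Each round uses up [q.+1] free edges and adds exactly one edge to Client's graph: the claimed
    edge was still free, while every edge claimed earlier had already been offered. *)
Lemma card_edges_play h :
  play q h -> (#|client_graph h| * q.+1 + #|free_edges h| = 'C(n, 2))%N.
Proof.
elim=> [|{}h O e hp IH /andP[OF /eqP cO] eO].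
  have -> : client_graph [::] = finset.set0 :> {set {set 'I_n}}.
    by apply/setP => x; rewrite !inE.
  by rewrite /free_edges big_nil finset.setD0 cards0 card_draws card_ord.
rewrite client_graph_rcons free_edges_rcons cardsU1 -IH.
have -> : e \notin client_graph h.
  apply/negP => /(fintype.subsetP (client_graph_offered hp)) eU.
  by have := fintype.subsetP OF e eO; rewrite finset.inE eU.
rewrite -(cardsID O (free_edges h)) (finset.setIidPr OF) cO; lia.
Qed.

(** * Double counting and Waiter's lower bound *)

Lemma handshake G :
  G \subset Kn_edges n -> (\sum_(v < n) degree G v = 2 * #|G|)%N.
Proof.
move=> /fintype.subsetP GK; rewrite /degree.
under eq_bigr => v _ do rewrite -sum1dep_card.
rewrite (exchange_big_dep (mem G)) /=; last by move=> v e _ /andP[].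
rewrite -sum1_card big_distrr /=; apply: eq_bigr => e eG.
rewrite muln1; have := GK e eG; rewrite inE => /eqP <-.
by rewrite -sum1_card; apply: eq_bigl => v; rewrite eG.
Qed.

Lemma card_le_max_degree G :
  G \subset Kn_edges n -> (2 * #|G| <= n * max_degree G)%N.
Proof.
move=> /handshake <-; rewrite -[X in (_ <= X * _)%N](card_ord n) -sum_nat_const.
by apply: leq_sum => v _; apply: leq_bigmax.
Qed.

Lemma exists_legal_offer h : ~~ game_over q h -> exists O, legal_offer q h O.
Proof.
rewrite /game_over -leqNgt => qF.
have : (0 < #|[set A : {set {set 'I_n}} | A \subset free_edges h & #|A| == q.+1]|)%N.
  by rewrite cards_draws bin_gt0.
by case/card_gt0P => O; rewrite finset.inE => OP; exists O.
Qed.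

(** Any legal strategy will do. At the end at most [q] edges are free, which costs the term [2 * q]
    once the edge count is doubled to compare it with the degree sum. *)
Lemma waiter_can_force_average :
  waiter_can_force q (fun G : {set {set 'I_n}} =>
    (n * n.-1 <= n * max_degree G * q.+1 + 2 * q)%N).
Proof.
(* The default [set0] is never offered before the game is over, by [exists_legal_offer]. *)
exists (fun h => odflt finset.set0 [pick O | legal_offer q h O]).
  move=> h _ /exists_legal_offer [A legA] /=.
  by case: pickP => [//|/(_ A)]; rewrite legA.
move=> h hp; rewrite /game_over ltnS => hq _.
have := card_edges_play hp; have := card_le_max_degree (client_graph_Kn hp).
have : (n * n.-1 = 2 * 'C(n, 2))%N by rewrite -mul_bin_diag bin1.
nia.
Qed.

(** * Degree estimates and Client's potential strategy *)

Lemma degree_setU1 G e v : (degree (e |: G) v <= degree G v + (v \in e))%N.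
Proof.
rewrite /degree; case: (boolP (v \in e)) => ve.
  rewrite addn1 -add1n -(cards1 e).
  apply: leq_trans (leq_card_setU _ _); apply: subset_leq_card.
  by apply/fintype.subsetP => x; rewrite !inE; case: eqP.
rewrite addn0; apply: subset_leq_card.
apply/fintype.subsetP => x; rewrite !inE; case: eqP => //= ->.
by rewrite (negbTE ve).
Qed.

Lemma degreeD F O v :
  O \subset F -> degree F v = (degree O v + degree (F :\: O) v)%N.
Proof.
move=> OF; rewrite /degree -(cardsID O [set e in F | v \in e]).
congr (_ + _)%N; apply: eq_card => x; rewrite !inE.
  by case: (boolP (x \in O)) => [/(fintype.subsetP OF) ->|]; rewrite ?andbT ?andbF.
by rewrite andbA.
Qed.

Lemma degree_Kn v : (degree (Kn_edges n) v <= n)%N.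
Proof.
rewrite -[leqRHS](card_ord n) -cardsT.
(* Edges at [v] are pairs [[set v; u]]; letting [u] range over all vertices, [v] included, gives [n]
   instead of [n - 1]. *)
apply: leq_trans (leq_imset_card (fun u => [set v; u]) _).
apply: subset_leq_card; apply/fintype.subsetP => e; rewrite !inE => /andP[/cards2P].
case=> [x [y [xy ->]]]; rewrite !inE => /orP[/eqP->|/eqP->].
  by apply/imsetP; exists y.
by apply/imsetP; exists x => //; rewrite finset.setUC.
Qed.

Section Potential.

Variable R : realType.

(** The expectation of [2 ^ X] for a 0-1 variable [X] that is 1 with probability [1 / (q + 1)]. *)
Definition growth : R := 1 + q.+1%:R^-1.

(* The expectation of [\sum_v 2 ^ degree v] if Client were to receive each free edge
   independently with probability [1 / (q + 1)]. *)
Definition potential G F : R :=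
  \sum_(v < n) 2 ^+ degree G v * growth ^+ degree F v.

Lemma growth_ge1 : 1 <= growth.
Proof. by rewrite /growth lerDl invr_ge0. Qed.

Lemma bernoulli (m : nat) : 1 + m%:R / q.+1%:R <= growth ^+ m.
Proof.
elim: m => [|m IH]; first by rewrite expr0 mul0r addr0.
rewrite exprSr; apply: le_trans (ler_wpM2r _ IH); last first.
  exact: le_trans growth_ge1.
rewrite /growth -[m.+1%:R]natr1.
have : 0 <= m%:R / q.+1%:R / q.+1%:R :> R by rewrite !divr_ge0.
set t := _^-1; nra.
Qed.

(** Vertex by vertex: claiming [e] multiplies the term of [v] by at most 2 if [v \in e] and by 1
    otherwise, so these factors sum to at most [q + 1 + degree O v]. By [bernoulli] this is at most
    [q + 1] times [growth ^+ degree O v], the factor lost when [O] stops being free. *)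
Lemma sum_potential_le F G O : O \subset F -> #|O| = q.+1 ->
  \sum_(e in O) potential (e |: G) (F :\: O) <= q.+1%:R * potential G F.
Proof.
move=> OF cO; rewrite /potential exchange_big mulr_sumr /=.
apply: ler_sum => v _; rewrite (degreeD v OF) exprD.
set w := growth ^+ degree (F :\: O) v.
have w0 : 0 <= w by rewrite exprn_ge0 // (le_trans _ growth_ge1).
have d0 : 0 <= 2 ^+ degree G v :> R by rewrite exprn_ge0.
have s : \sum_(e in O) (1 + (v \in e)%:R) = q.+1%:R + (degree O v)%:R :> R.
  rewrite big_split /= sumr_const cO; congr (_ + _).
  rewrite -natr_sum -big_mkcondr /= /degree -sum1dep_card.
  by congr (_%:R).
apply: (@le_trans _ _ (\sum_(e in O) 2 ^+ degree G v * w * (1 + (v \in e)%:R))).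
  apply: ler_sum => e _; rewrite mulrAC; apply: ler_wpM2r => //.
  (* Only an inequality, as [e] may already belong to [G]. *)
  apply: (@le_trans _ _ (2 ^+ (degree G v + (v \in e)))).
    by rewrite ler_eXn2l ?degree_setU1 // ltr1n.
  by rewrite exprD; case: (v \in e); rewrite ?expr1 ?expr0 ?addr0.
rewrite -mulr_sumr s.
have -> : q.+1%:R + (degree O v)%:R = q.+1%:R * (1 + (degree O v)%:R / q.+1%:R) :> R.
  by rewrite mulrDr mulr1 mulrCA divff ?mulr1 ?pnatr_eq0.
rewrite mulrCA ler_wpM2l // -mulrA ler_wpM2l // mulrC ler_wpM2r //.
exact: bernoulli.
Qed.

(** Averaging: if each of the [q.+1] claims raised the potential, their sum would contradict
    [sum_potential_le]. *)
Lemma exists_good_claim F G O : O \subset F -> #|O| = q.+1 ->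
  exists2 e, e \in O & potential (e |: G) (F :\: O) <= potential G F.
Proof.
move=> OF cO; have := sum_potential_le G OF cO; rewrite leNgt => sle.
apply/exists_inP; apply: contraNT sle; rewrite negb_exists_in => /forall_inP H.
rewrite mulr_natl -cO -sumr_const; apply: ltr_sum.
  have /card_gt0P[e eO] : (0 < #|O|)%N by rewrite cO.
  by apply/hasP; exists e; rewrite ?mem_index_enum.
by move=> e eO; rewrite ltNge H.
Qed.

Lemma potential_ge G F : (n > 0)%N -> 2 ^+ max_degree G <= potential G F.
Proof.
move=> n0; rewrite /max_degree.
have [|v ->] := @bigop.eq_bigmax _ (degree G); first by rewrite card_ord.
rewrite /potential (bigD1 v) //=.
have g0 : 0 <= growth by apply: le_trans growth_ge1.
rewrite ler_wpDr ?sumr_ge0 //; first by move=> *; rewrite mulr_ge0 ?exprn_ge0.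
by rewrite ler_peMr ?exprn_ge0 // exprn_ege1 // growth_ge1.
Qed.

Lemma potential_start : potential (client_graph [::]) (free_edges [::]) <=
  n%:R * growth ^+ n.
Proof.
rewrite mulr_natl -[X in _ *+ X](card_ord n) -sumr_const.
apply: ler_sum => v _.
have -> : degree (client_graph [::]) v = 0%N.
  by apply: eq_card0 => x; rewrite !inE.
rewrite expr0 mul1r /free_edges big_nil finset.setD0.
by rewrite ler_weXn2l ?growth_ge1 ?degree_Kn.
Qed.

Lemma client_can_ensure_potential : (n > 0)%N ->
  client_can_ensure q (fun G : {set {set 'I_n}} =>
    2 ^+ max_degree G <= n%:R * growth ^+ n).
Proof.
move=> n0.
pose good h O e := (e \in O) &&
  (potential (e |: client_graph h) (free_edges h :\: O) <=
   potential (client_graph h) (free_edges h)).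
(* The default is not reached on a legal offer, by [exists_good_claim]. *)
pose s h O : {set 'I_n} := odflt finset.set0 [pick e | good h O e].
have sP h O : legal_offer q h O -> good h O (s h O).
  case/andP=> OF /eqP cO; rewrite /s; case: pickP => [//|none].
  have [e eO le] := exists_good_claim (client_graph h) OF cO.
  by have := none e; rewrite /good eO le.
exists s; first by move=> h O _ /sP /andP[].
move=> h hp _ fol; apply: le_trans potential_start.
apply: le_trans (potential_ge _ (free_edges h) n0) _.
elim: hp fol => // {}h O e hp IH leg eO fol.
rewrite client_graph_rcons free_edges_rcons.
have -> : e = s h O by apply: (fol h O e [::]); rewrite cats1.
have /andP[_ le] := sP h O leg; apply: le_trans le (IH _).
(* A prefix of a play that follows [s] follows [s] too: the last round is appended to the
   continuation [h2]. *)
move=> h1 O1 e1 h2 eqh; apply: (fol h1 O1 e1 (rcons h2 (O, e))).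
by rewrite eqh rcons_cat.
Qed.

End Potential.

End Game.

Local Open Scope classical_set_scope.
Local Open Scope ring_scope.

(** * Asymptotic form of the two bounds *)

Section Asymptotics.

Variables (R : realType) (c : R).
Hypothesis c_gt0 : 0 < c.

Lemma bias_le n : (2 <= n)%N -> (bias c n)%:R * ln n%:R <= c * n%:R :> R.
Proof.
move=> n2; have L0 : 0 < ln n%:R :> R by rewrite ln_gt0 // ltr1n.
rewrite -ler_pdivlMr // -mulrA truncn_le.
by rewrite mulr_ge0 ?divr_ge0 // ltW.
Qed.

Lemma cvg_opp_div_nat (K : R) : (fun n => - (K / n%:R)) @ \oo --> (0 : R).
Proof.
(* The shift turns [1 / n] into the harmonic sequence [1 / (n + 1)]. *)
rewrite -cvg_shiftS.
have := @cvgMl_tmp R nat \oo _ _ (- K) _ (@cvg_harmonic R); rewrite mulr0 => lim.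
by under eq_fun do rewrite -mulNr; exact: lim.
Qed.

(** Division by [n (q + 1)] gives [D >= (n - 1 - 2 q / n) / (q + 1)], and [q / n] is bounded by a
    constant. *)
Lemma average_degree_bound n D : (2 <= n)%N ->
    (n * n.-1 <= n * D * (bias c n).+1 + 2 * bias c n)%N ->
  (1 - (1 + 2 * c / ln 2) / n%:R) * (n%:R / (bias c n).+1%:R) <= D%:R.
Proof.
move=> n2; have := bias_le n2; set q := bias c n => qL.
rewrite -(ler_nat R) !(natrD, natrM) -subn1 natrB; last by lia.
have n0 : 0 < n%:R :> R by rewrite ltr0n; lia.
have l20 : 0 < ln 2 :> R by rewrite ln_gt0 // ltr1n.
(* The crude estimate [ln n >= ln 2] is enough to make the relative error [O(1 / n)]. *)
have qn : q%:R <= c / ln 2 * n%:R.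
  rewrite mulrAC ler_pdivlMr //; apply: le_trans qL.
  by rewrite ler_wpM2l // ler_ln ?posrE // ler_nat.
move=> H; rewrite mulrA ler_pdivrMr ?ltr0n // mulrBl mul1r divfK ?gt_eqF //.
rewrite -(ler_pM2l n0) -[2 * c / _]mulrA.
by move: qn H; move: (c / ln 2) q%:R q.+1%:R => k x y; lra.
Qed.

(** Taking logarithms, [D ln 2 <= ln n + n ln (growth)]; the last summand is at most [n / (q + 1)]
    because [ln (1 + x) <= x]. *)
Lemma potential_degree_bound n D : (2 <= n)%N -> (1 <= bias c n)%N ->
    2 ^+ D <= n%:R * growth (bias c n) R ^+ n ->
  D%:R <= (1 + 2 * c) / ln 2 * (n%:R / (bias c n).+1%:R).
Proof.
move=> n2; have := bias_le n2; set q := bias c n => qL q1 H.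
have n0 : 0 < n%:R :> R by rewrite ltr0n; lia.
have l20 : 0 < ln 2 :> R by rewrite ln_gt0 // ltr1n.
have g0 : 0 < growth q R by apply: lt_le_trans (growth_ge1 _ _).
have : ln (2 ^+ D) <= ln (n%:R * growth q R ^+ n) :> R.
  by rewrite ler_ln ?posrE ?mulr_gt0 ?exprn_gt0.
rewrite lnM ?posrE ?exprn_gt0 // !lnXn // -[leLHS]mulr_natl -[X in _ + X]mulr_natl => {}H.
have lng : ln (growth q R) <= q.+1%:R^-1.
  by apply: le_ln1Dx; apply: (@lt_le_trans _ _ 0); rewrite ?invr_ge0 // oppr_lt0.
(* The factor 2 comes from [q + 1 <= 2 q], valid since [q >= 1]. *)
have L : ln n%:R <= 2 * c * (n%:R / q.+1%:R).
  have q0 : 0 < q%:R :> R by rewrite ltr0n.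
  have L0 : 0 < ln n%:R :> R by rewrite ln_gt0 // ltr1n.
  rewrite mulrA ler_pdivlMr ?ltr0n // -natr1.
  have : 1 <= q%:R :> R by rewrite ler1n.
  nra.
rewrite mulrAC ler_pdivlMr //; apply: le_trans H _.
rewrite mulrDl mul1r addrC; apply: lerD => //.
by rewrite ler_wpM2l // ltW.
Qed.

End Asymptotics.

Theorem proposition1p6 (R : realType) (c : R) (hc : 0 < c) :
  exists (eps : nat -> R) (C : R),
    [/\ eps @ \oo --> (0 : R),
        0 < C &
        forall n : nat, (2 <= n)%N -> (1 <= bias c n)%N ->
          let q := bias c n in
          waiter_can_force q (fun G : {set {set 'I_n}} =>
            (1 + eps n) * (n%:R / q.+1%:R) <= (max_degree G)%:R)
          /\
          client_can_ensure q (fun G : {set {set 'I_n}} =>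
            (max_degree G)%:R <= C * (n%:R / q.+1%:R))].
Proof.
exists (fun n => - ((1 + 2 * c / ln 2) / n%:R)), ((1 + 2 * c) / ln 2); split.
- exact: cvg_opp_div_nat.
- by rewrite divr_gt0 ?ln_gt0 ?ltr1n // addr_gt0 // mulr_gt0.
move=> n n2 q1 q; split.
  have [s sl sP] := waiter_can_force_average n q.
  exists s => // h hp over fol.
  exact: average_degree_bound (sP h hp over fol).
have [s sl sP] := client_can_ensure_potential q R (ltnW n2).
exists s => // h hp over fol.
exact: potential_degree_bound (sP h hp over fol).
Qed.
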